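(* Let $a<b$ be real numbers, let $f:\mathbb{N}_a\cap{_{b}\mathbb{N}}\to\mathbb{R}$ and let $f^*:\mathbb{N}_{-b}\cap{_{-a}\mathbb{N}}\to\mathbb{R}$, $f^*(t)=f(-t)$, be its symmetric dual. Let $n\geq 1$ be an integer and $n-1<\alpha\leq n$. Then for every $t\in\mathbb{N}_a\cap{_{b}\mathbb{N}}$, $$(\Delta_a^{-\alpha}f)(\sigma^{\alpha}(t))=({_{-a}\Delta^{-\alpha}}f^* )(-\sigma^{\alpha}(t)),$$ where $\sigma^{\alpha}(t)=t+\alpha$.
   Context: For real $a,b$: $\mathbb{N}_a=\{a,a+1,\ldots\}$, ${_{b}\mathbb{N}}=\{b,b-1,\ldots\}$. $\sigma(t)=t+1$, $\rho(t)=t-1$. Factorial function: $t^{(\alpha)}=\Gamma(t+1)/\Gamma(t+1-\alpha)$ for real $\alpha$, with the convention that division at a pole yields zero. For $\alpha>0$, the delta left fractional sum starting from $a$ is $$\Delta_a^{-\alpha}f(t)=\frac{1}{\Gamma(\alpha)}\sum_{s=a}^{t-\alpha}(t-\sigma(s))^{(\alpha-1)}f(s),\quad t\in\mathbb{N}_{a+\alpha},$$ and the delta right fractional sum ending at $b$ is $${_{b}\Delta^{-\alpha}}f(t)=\frac{1}{\Gamma(\alpha)}\sum_{s=t+\alpha}^{b}(s-\sigma(t))^{(\alpha-1)}f(s),\quad t\in{_{b-\alpha}\mathbb{N}}.$$ For functions defined only on a finite set of points, these are considered at those $t$ for which all values occurring are defined. *)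

(* Defs.v *)
From mathcomp Require Import all_boot all_order all_algebra.
From mathcomp Require Import all_classical all_reals all_analysis.

Set Implicit Arguments.
Unset Strict Implicit.
Unset Printing Implicit Defensive.

Import Order.TTheory GRing.Theory Num.Theory.
Local Open Scope classical_set_scope.
Local Open Scope ring_scope.

Definition Nfrom (R : realType) (a : R) : set R :=
  [set x | exists k : nat, x = a + k%:R].

Definition Ndownfrom (R : realType) (b : R) : set R :=
  [set x | exists k : nat, x = b - k%:R].

(* Both {a, a+1, ..., b} and the index set of a sum over s = a, ..., b with
   step 1; it is finite, and empty unless b - a is a nonnegative integer. *)
Definition grid (R : realType) (a b : R) : set R := Nfrom a `&` Ndownfrom b.

Definition sigma (R : realType) (t : R) : R := t + 1.

Definition sigma_pow (R : realType) (alpha t : R) : R := t + alpha.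

Definition Euler_integral (R : realType) (x : R) : R :=
  \int[lebesgue_measure]_(u in `]0, +oo[%classic) (u `^ (x - 1) * expR (- u)).

Definition Gamma_pole (R : realType) (x : R) : Prop :=
  exists k : nat, x = - k%:R.

(* Euler's integral converges for x > 0 only.  For x <= 0, Gamma is extended by
   Gamma x = Gamma (x + m) / (x (x + 1) ... (x + m - 1)), where m is the least
   natural number such that x + m > 0.  Poles are sent to the junk value 0. *)
Definition Gamma (R : realType) (x : R) : R :=
  let m := if 0 < x then 0%N else (Num.truncn (- x)).+1 in
  Euler_integral (x + m%:R) / \prod_(k < m) (x + k%:R).

(* t^(alpha), with the convention that division at a pole yields zero. *)
Definition falling (R : realType) (t alpha : R) : R :=
  if `[< Gamma_pole (t + 1 - alpha) >] then 0
  else Gamma (t + 1) / Gamma (t + 1 - alpha).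

(* A function on a grid is represented by a total function whose values off the
   grid are irrelevant.  The left sum is meaningful for t in
   Nfrom (a + alpha), the right one for t in Ndownfrom (b - alpha). *)
Definition delta_left_sum (R : realType) (alpha a : R) (f : R -> R) (t : R) : R :=
  (Gamma alpha)^-1 *
  \sum_(s \in grid a (t - alpha)) falling (t - sigma s) (alpha - 1) * f s.

Definition delta_right_sum (R : realType) (alpha b : R) (f : R -> R) (t : R) : R :=
  (Gamma alpha)^-1 *
  \sum_(s \in grid (t + alpha) b) falling (s - sigma t) (alpha - 1) * f s.

(* fs is constrained on its own domain only, and involves f on grid a b only. *)
Definition is_symmetric_dual (R : realType) (a b : R) (f fs : R -> R) : Prop :=
  forall t, grid (- b) (- a) t -> fs t = f (- t).

(* Main.v *)
Require Import Defs.
From mathcomp Require Import all_boot all_order all_algebra.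
From mathcomp Require Import all_classical all_reals all_analysis.
From mathcomp Require Import ring.

Import GRing.Theory.

Local Open Scope ring_scope.

(** The reflection [s] to [- s] turns one sum into the other. At the given points the shifts by
    [alpha] cancel, so the left sum runs over [grid a t] and the right one over [grid (- t) (- a)],
    its mirror image ([oppr_grid_bij]). Terms then agree one by one, with the same factor
    [Gamma alpha] in front. *)

(** Negation exchanges the step counts from the two endpoints, hence the crossed witnesses. *)
Lemma grid_opp {R : realType} {a b s : R} :
  grid a b s -> grid (- b) (- a) (- s).
Proof.
by case=> -[k sk] [j sj]; split;
  [exists j; rewrite sj | exists k; rewrite sk]; ring.
Qed.

Lemma oppr_grid_bij {R : realType} (a b : R) :
  set_bij (grid a b) (grid (- b) (- a)) -%R.
Proof.
split.
- by move=> s; apply: grid_opp.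
- by move=> x y _ _; apply: oppr_inj.
- move=> s /grid_opp; rewrite !opprK => gs.
  by exists (- s); rewrite ?opprK.
Qed.

(** Steps down from [b] to [t] and from [t] to [s] add up. This keeps summation indices where [fs]
    is constrained. *)
Lemma grid_subset_right {R : realType} {a b t s : R} :
  grid a b t -> grid a t s -> grid a b s.
Proof.
move=> [_ [m tm]] [sa [j sj]]; split=> //.
by exists (m + j)%N; rewrite sj tm natrD; ring.
Qed.

Theorem theorem27 (R : realType) (a b : R) (hab : a < b) (f fs : R -> R)
    (hfs : is_symmetric_dual a b f fs)
    (n : nat) (hn : (1 <= n)%N) (alpha : R)
    (halpha1 : n%:R - 1 < alpha) (halpha2 : alpha <= n%:R) :
  forall t : R, grid a b t ->
    delta_left_sum alpha a f (sigma_pow alpha t)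
    = delta_right_sum alpha (- a) fs (- sigma_pow alpha t).
Proof.
move=> t gt; rewrite /delta_left_sum /delta_right_sum /sigma_pow; congr (_ * _).
have -> : t + alpha - alpha = t by ring.
have -> : - (t + alpha) + alpha = - t by ring.
rewrite [RHS](reindex_fsbig -%R (grid a t)); last exact: oppr_grid_bij.
apply: eq_fsbigr => s; rewrite inE => gs.
rewrite hfs; last exact: (grid_opp (grid_subset_right gt gs)).
rewrite opprK; congr (falling _ _ * _).
(* Both arguments of [falling] equal [t + alpha - s - 1]. *)
by rewrite /sigma; ring.
Qed.
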